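(* Let $\varphi:(M^{2n+2},g)\to(N^{2n},J,h)$ be a pseudo horizontally weakly conformal (PHWC) submersion with (real) two-dimensional fibers from an oriented Riemannian manifold to a Hermitian manifold. Consider on $M$ one of the two induced almost complex structures $J^{\pm}=(J_{\mathcal H},\pm J_{\mathcal V})$, which are compatible with $g$. If the fibers of $\varphi$ are superminimal with respect to this almost complex structure, then this almost complex structure is integrable.
   Context: A map $\varphi:(M,g)\to(N,J,h)$ is PHWC if $[d\varphi\circ d\varphi^{*},J]=0$, where $d\varphi_x^*:T_{\varphi(x)}N\to T_xM$ is the adjoint, $g(X,d\varphi_x^*(E))=h(d\varphi_x(X),E)$. A Hermitian manifold has integrable $J$. Let $\mathcal V=\ker d\varphi$, $\mathcal H=\mathcal V^\perp$. $J_{\mathcal H}=(d\varphi|_{\mathcal H})^{-1}\circ J\circ d\varphi|_{\mathcal H}$ is an almost complex structure on $\mathcal H$, compatible with $g$ by PHWC, and it orients $\mathcal H$. Orient the rank-2 bundle $\mathcal V$ so that $\mathcal H\oplus\mathcal V$ has the orientation of $M$, and let $J_{\mathcal V}$ be rotation through $+\pi/2$ in $\mathcal V$. Then $J^{+}=(J_{\mathcal H},J_{\mathcal V})$ and $J^{-}=(J_{\mathcal H},-J_{\mathcal V})$ are almost Hermitian structures on $(M,g)$ for which $\varphi$ is holomorphic. An almost complex submanifold $P$ of an almost Hermitian manifold $(M,J',g)$ is superminimal if $\nabla_VJ'=0$ for all vectors $V$ tangent to $P$, where $\nabla$ is the Levi-Civita connection of $g$ on $M$. *)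

(* Defs.v *)
(* Manifolds are given by atlases, and tensor fields by
   their components in the charts together with the transformation law.
   Tangent vectors are row vectors of components, so linear maps act on the
   right: the differential of [f] is [v |-> v *m jacobian f x], and composition
   of endomorphisms reads from left to right. *)
From mathcomp Require Import all_boot all_order all_algebra.
From mathcomp Require Import all_classical all_reals all_analysis.
Import Order.TTheory GRing.Theory Num.Theory.
Import numFieldNormedType.Exports.

Set Implicit Arguments.
Unset Strict Implicit.
Unset Printing Implicit Defensive.

Local Open Scope classical_set_scope.
Local Open Scope ring_scope.

(* C^oo on the open set [U]: every iterated directional derivative exists and
   is Frechet differentiable at every point of [U]. *)
Definition smooth_on (R : realType) (V W : normedModType R) (U : set V)
    (f : V -> W) : Prop :=
  forall (vs : seq V) (x : V), U x ->
    differentiable (foldr (fun v h => 'D_v h) f vs) x.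

Record chart (R : realType) (m : nat) (T : topologicalType) := Chart {
  cdom : set T;
  cmap :> T -> 'rV[R]_m;
  cinv : 'rV[R]_m -> T;
  cdom_open : open cdom;
  cimg_open : open (cmap @` cdom);
  cmapK : {in cdom, cancel cmap cinv};
  cmap_continuous : forall p, cdom p -> {for p, continuous cmap};
  cinv_continuous : forall x, (cmap @` cdom) x -> {for x, continuous cinv} }.

Definition cimg (R : realType) (m : nat) (T : topologicalType)
  (c : chart R m T) : set 'rV[R]_m := c @` cdom c.

Record manifold (R : realType) (m : nat) := Manifold {
  carrier :> topologicalType;
  carrier_hausdorff : hausdorff_space carrier;
  carrier_second_countable : second_countable (T := carrier);
  atlas_index : Type;
  atlas : atlas_index -> chart R m carrier;
  atlas_cover : forall p, exists a, cdom (atlas a) p;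
  atlas_compatible : forall a b,
    smooth_on [set x | cimg (atlas a) x /\ cdom (atlas b) (cinv (atlas a) x)]
              (atlas b \o cinv (atlas a)) }.

Section Manifold.
Variables (R : realType) (m : nat) (M : manifold R m).
Implicit Types (a b : atlas_index M) (x v w : 'rV[R]_m).

Definition overlap a b : set 'rV[R]_m :=
  [set x | cimg (atlas a) x /\ cdom (atlas b) (cinv (atlas a) x)].

Definition transition a b : 'rV[R]_m -> 'rV[R]_m :=
  atlas b \o cinv (atlas a).

(* [M] is oriented by its atlas: the positive bases of a tangent space are
   those whose matrix of components in the charts of the atlas has positive
   determinant. *)
Definition oriented : Prop :=
  forall a b x, overlap a b x -> 0 < \det (jacobian (transition a b) x).

Definition inner (k : nat) (G : 'M[R]_k) (v w : 'rV[R]_k) : R :=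
  (v *m G *m w^T) 0 0.

Record riemannian_metric := Metric {
  gmat :> atlas_index M -> 'rV[R]_m -> 'M[R]_m;
  gmat_smooth : forall a, smooth_on (cimg (atlas a)) (gmat a);
  gmat_sym : forall a x, cimg (atlas a) x -> (gmat a x)^T = gmat a x;
  gmat_pos : forall a x v, cimg (atlas a) x -> v != 0 ->
    0 < inner (gmat a x) v v;
  gmat_change : forall a b x, overlap a b x ->
    gmat a x = jacobian (transition a b) x *m gmat b (transition a b x)
               *m (jacobian (transition a b) x)^T }.

Record endo := Endo {
  emat :> atlas_index M -> 'rV[R]_m -> 'M[R]_m;
  emat_smooth : forall a, smooth_on (cimg (atlas a)) (emat a);
  emat_change : forall a b x, overlap a b x ->
    emat a x *m jacobian (transition a b) x =
    jacobian (transition a b) x *m emat b (transition a b x) }.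

Definition almost_complex (J : endo) : Prop :=
  forall a x, cimg (atlas a) x -> J a x *m J a x = - 1%:M.

Definition compatible (g : riemannian_metric) (J : endo) : Prop :=
  forall a x v w, cimg (atlas a) x ->
    inner (g a x) (v *m J a x) (w *m J a x) = inner (g a x) v w.

Definition lie (X Y : 'rV[R]_m -> 'rV[R]_m) (x : 'rV[R]_m) : 'rV[R]_m :=
  'D_(X x) Y x - 'D_(Y x) X x.

Definition endo_act (J : endo) a (X : 'rV[R]_m -> 'rV[R]_m) :
    'rV[R]_m -> 'rV[R]_m :=
  fun x => X x *m J a x.

Definition nijenhuis (J : endo) a (X Y : 'rV[R]_m -> 'rV[R]_m) x : 'rV[R]_m :=
  lie (endo_act J a X) (endo_act J a Y) x - lie (endo_act J a X) Y x *m J a x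
  - lie X (endo_act J a Y) x *m J a x - lie X Y x.

(* Integrability of an almost complex structure is the vanishing of its
   Nijenhuis torsion. *)
Definition integrable_structure (J : endo) : Prop :=
  almost_complex J /\
  forall a (X Y : 'rV[R]_m -> 'rV[R]_m),
    smooth_on (cimg (atlas a)) X -> smooth_on (cimg (atlas a)) Y ->
    forall x, cimg (atlas a) x -> nijenhuis J a X Y x = 0.

Definition hermitian_structure (g : riemannian_metric) (J : endo) : Prop :=
  integrable_structure J /\ compatible g J.

Definition dgmat (g : riemannian_metric) a x (i j k : 'I_m) : R :=
  ('D_(delta_mx 0 i) (g a) x) j k.

(* Christoffel symbol with upper index [k] and lower indices [i], [j]. *)
Definition christoffel (g : riemannian_metric) a x (k i j : 'I_m) : R :=
  2^-1 * \sum_l invmx (g a x) k l *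
    (dgmat g a x i j l + dgmat g a x j i l - dgmat g a x l i j).

(* Levi-Civita covariant derivative of [Y] at [x] in the direction [v]. *)
Definition nabla (g : riemannian_metric) a x v (Y : 'rV[R]_m -> 'rV[R]_m) :
    'rV[R]_m :=
  'D_v Y x +
  \row_k \sum_i \sum_j v 0 i * Y x 0 j * christoffel g a x k i j.

Definition parallel_along (g : riemannian_metric) (J : endo) a x v : Prop :=
  forall Y : 'rV[R]_m -> 'rV[R]_m, smooth_on (cimg (atlas a)) Y ->
    nabla g a x v (endo_act J a Y) = nabla g a x v Y *m J a x.

(* Superminimality at [x] of a submanifold whose tangent space is [T]. *)
Definition superminimal_at (g : riemannian_metric) (J : endo) a x
    (T : set 'rV[R]_m) : Prop :=
  (forall v, T v -> T (v *m J a x)) /\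
  (forall v, T v -> parallel_along g J a x v).

End Manifold.

Section Map.
Variables (R : realType) (m k : nat) (M : manifold R m) (N : manifold R k).
Variable phi : M -> N.
Implicit Types (a : atlas_index M) (b : atlas_index N) (x : 'rV[R]_m).

Definition locdom a b : set 'rV[R]_m :=
  [set x | cimg (atlas a) x /\ cdom (atlas b) (phi (cinv (atlas a) x))].

Definition locmap a b : 'rV[R]_m -> 'rV[R]_k :=
  atlas b \o phi \o cinv (atlas a).

Definition smooth_map : Prop :=
  continuous phi /\ forall a b, smooth_on (locdom a b) (locmap a b).

Definition dmap a b x : 'M[R]_(m, k) := jacobian (locmap a b) x.

Definition submersion : Prop :=
  forall a b x, locdom a b x -> row_full (dmap a b x).

(* [B] is the matrix of the adjoint of the differential, so [B *m dmap a b x]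
   is that of the composite of the differential after its adjoint. *)
Definition phwc (g : riemannian_metric M) (h : riemannian_metric N)
    (J : endo N) : Prop :=
  forall a b x, locdom a b x ->
    exists2 B : 'M[R]_(k, m),
      (forall (X : 'rV[R]_m) (E : 'rV[R]_k),
         inner (g a x) X (E *m B) =
         inner (h b (locmap a b x)) (X *m dmap a b x) E) &
      B *m dmap a b x *m J b (locmap a b x) =
      J b (locmap a b x) *m (B *m dmap a b x).

(* As [phi] is a submersion, this is also the tangent space of the fiber. *)
Definition vertical a b x : set 'rV[R]_m := [set v | v *m dmap a b x = 0].

Definition horizontal (g : riemannian_metric M) a b x : set 'rV[R]_m :=
  [set v | forall w, vertical a b x w -> inner (g a x) v w = 0].

(* [u = J_H v], for [v] horizontal *)
Definition JH_rel (g : riemannian_metric M) (J : endo N) a b x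
    (v u : 'rV[R]_m) : Prop :=
  horizontal g a b x u /\
  u *m dmap a b x = v *m dmap a b x *m J b (locmap a b x).

Definition superminimal_fibers (g : riemannian_metric M) (J' : endo M) : Prop :=
  forall a b x, locdom a b x ->
    superminimal_at g J' a x (vertical a b x).

End Map.

Section Induced.
Variables (R : realType) (n : nat).
Variables (M : manifold R (2 * n + 2)) (N : manifold R (2 * n)).
Variables (phi : M -> N) (g : riemannian_metric M) (J : endo N).
Implicit Types (v w : 'rV[R]_(2 * n + 2)).

(* the matrix with rows e_0, f_0, ..., e_(n-1), f_(n-1), v, w *)
Definition adapted_frame (e f : nat -> 'rV[R]_(2 * n + 2)) v w
    : 'M[R]_(2 * n + 2) :=
  \matrix_(i < 2 * n + 2)
    if (i < 2 * n)%N then (if odd i then f i./2 else e i./2)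
    else if i == (2 * n)%N :> nat then v else w.

(* (v, w) is a positive basis of the vertical space, oriented so that a basis
   e_0, J_H e_0, ..., e_(n-1), J_H e_(n-1) of the horizontal space followed by
   (v, w) is positive in [M]. *)
Definition vertical_positive a b x v w : Prop :=
  exists e f : nat -> 'rV[R]_(2 * n + 2),
    (forall i, (i < n)%N -> horizontal phi g a b x (e i) /\
                            JH_rel phi g J a b x (e i) (f i)) /\
    0 < \det (adapted_frame e f v w).

(* [u = J_V v], for [v] vertical *)
Definition JV_rel a b x v u : Prop :=
  [/\ vertical phi a b x u, inner (g a x) u v = 0,
      inner (g a x) u u = inner (g a x) v v &
      v != 0 -> vertical_positive a b x v u].

(* [J'] is J^+ if [s = false] and J^- if [s = true]. *)
Definition induced_structure (s : bool) (J' : endo M) : Prop :=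
  forall a b x, locdom phi a b x ->
    (forall v, horizontal phi g a b x v ->
       JH_rel phi g J a b x v (v *m J' a x)) /\
    (forall v, vertical phi a b x v ->
       JV_rel a b x v ((-1) ^+ s *: (v *m J' a x))).

End Induced.

(* Main.v *)
(* Work in a chart, near a point.  PHWC makes the horizontal space the image of
   the adjoint of D = dphi and J_H an isometry of it, so J' D = D J (row-vector
   convention) and J' is g-skew.  Let Q v be the covariant derivative of J' in
   the direction v; since the connection has no torsion,
     N(v, w) = w Q(v J') - v Q(w J') + v Q(w) J' - w Q(v) J',
   and each Q v is g-skew and anticommutes with J'.  Differentiating J' D = D J
   and using the symmetry of second derivatives, N(v, w) D is the Nijenhuis
   torsion of J at (v D, w D), hence N(v, w) is vertical.  For u vertical,
   superminimality leaves N(v, u) = u (Q(v J') - Q(v) J'), which the symmetries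
   of Q make orthogonal to u and u J', a basis of the vertical plane: so
   N(v, u) = 0, that is u Q(v J') = u Q(v) J'.  With this identity, the same
   symmetries make N(v, w) orthogonal to every vertical u, so it vanishes. *)
Require Import Defs.
From mathcomp Require Import all_boot all_order all_algebra.
From mathcomp Require Import all_classical all_reals all_analysis.
From mathcomp Require Import ring lra.
Import Order.TTheory GRing.Theory Num.Theory.
Import numFieldNormedType.Exports.

Set Implicit Arguments.
Unset Strict Implicit.
Unset Printing Implicit Defensive.

Local Open Scope classical_set_scope.
Local Open Scope ring_scope.

(** * Linear algebra of a positive definite symmetric form *)

Section Inner.
Variables (R : realType) (m : nat) (G : 'M[R]_m).
Implicit Types (u v w : 'rV[R]_m).

Lemma innerDl u v w : inner G (u + v) w = inner G u w + inner G v w.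
Proof. by rewrite /inner !mulmxDl mxE. Qed.

Lemma innerDr u v w : inner G u (v + w) = inner G u v + inner G u w.
Proof. by rewrite /inner linearD mulmxDr mxE. Qed.

Lemma innerZl c v w : inner G (c *: v) w = c * inner G v w.
Proof. by rewrite /inner -!scalemxAl mxE. Qed.

Lemma innerNl v w : inner G (- v) w = - inner G v w.
Proof. by rewrite /inner !mulNmx mxE. Qed.

Lemma innerNr v w : inner G v (- w) = - inner G v w.
Proof. by rewrite /inner linearN mulmxN mxE. Qed.

Lemma inner0l w : inner G 0 w = 0.
Proof. by rewrite /inner !mul0mx mxE. Qed.

Lemma inner0r w : inner G w 0 = 0.
Proof. by rewrite /inner trmx0 mulmx0 mxE. Qed.

Lemma innerC v w : G^T = G -> inner G v w = inner G w v.
Proof.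
move=> Gsym; have -> : inner G v w = (v *m G *m w^T)^T 0 0 by rewrite [RHS]mxE.
by rewrite !trmx_mul trmxK Gsym mulmxA.
Qed.

Lemma inner_trmx (A : 'M[R]_m) v w :
  inner G v (w *m A) = (v *m (G *m A^T) *m w^T) 0 0.
Proof. by rewrite /inner trmx_mul !mulmxA. Qed.

Lemma inner_eq0 v : (forall u, u != 0 -> 0 < inner G u u) ->
  inner G v v = 0 -> v = 0.
Proof.
by move=> Gpos v0; apply: contra_eq v0 => /Gpos /gt_eqF ->.
Qed.

Lemma inner_unitmx : (forall u, u != 0 -> 0 < inner G u u) -> G \in unitmx.
Proof.
move=> Gpos; rewrite -row_free_unit; apply: inj_row_free => v vG.
by apply: inner_eq0 => //; rewrite /inner vG mul0mx mxE.
Qed.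

(** Otherwise [z], [u], [u'] would be three nonzero pairwise orthogonal vectors, hence independent,
    in the kernel of [D], which has dimension 2. *)
Lemma plane_orthogonal_eq0 k (D : 'M[R]_(m, k)) z u u' :
  G^T = G -> (forall v, v != 0 -> 0 < inner G v v) -> (\rank D + 2 = m)%N ->
  z *m D = 0 -> u *m D = 0 -> u' *m D = 0 -> u != 0 -> u' != 0 ->
  inner G u u' = 0 -> inner G z u = 0 -> inner G z u' = 0 -> z = 0.
Proof.
move=> Gsym Gpos rkD zD uD u'D u0 u'0 uu' zu zu'.
apply/eqP/negPn/negP => z0.
pose A := col_mx z (col_mx u u').
have AD : A *m D = 0 by rewrite !mul_col_mx zD uD u'D !col_mx0.
have : row_free A.
  apply: inj_row_free => c.
  rewrite -[c]hsubmxK -[rsubmx c]hsubmxK !mul_row_col.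
  rewrite [lsubmx c]mx11_scalar [lsubmx (rsubmx c)]mx11_scalar.
  rewrite [rsubmx (rsubmx c)]mx11_scalar !mul_scalar_mx.
  set a := (lsubmx c) 0 0; set b := _ 0 0; set d := _ 0 0 => E.
  have nz v : v != 0 -> inner G v v <> 0 by move=> /Gpos /gt_eqF /eqP.
  have Ez : inner G (a *: z + (b *: u + d *: u')) z = 0 by rewrite E inner0l.
  have Eu : inner G (a *: z + (b *: u + d *: u')) u = 0 by rewrite E inner0l.
  have Eu' : inner G (a *: z + (b *: u + d *: u')) u' = 0.
    by rewrite E inner0l.
  move: Ez Eu Eu'; rewrite !innerDl !innerZl zu zu' uu' (innerC u z Gsym).
  rewrite (innerC u' z Gsym) (innerC u' u Gsym) uu' zu zu' !mulr0 !addr0 !add0r.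
  move=> /eqP; rewrite mulf_eq0 => /orP[/eqP->|/eqP /(nz _ z0)//].
  move=> /eqP; rewrite mulf_eq0 => /orP[/eqP->|/eqP /(nz _ u0)//].
  move=> /eqP; rewrite mulf_eq0 => /orP[/eqP->|/eqP /(nz _ u'0)//].
  by rewrite !raddf0 !row_mx0.
move=> /eqP rkA; have := mulmx0_rank_max AD.
by rewrite rkA -[X in (_ <= X)%N]rkD addnC leq_add2l.
Qed.

End Inner.

(** * Vanishing of the torsion, as algebra in a single tangent space *)

Section Torsion.
Variables (R : realType) (m k : nat) (G J : 'M[R]_m) (D : 'M[R]_(m, k)).
Variable Q : 'rV[R]_m -> 'M[R]_m.
Implicit Types (u v w x : 'rV[R]_m).

(* The Nijenhuis torsion of [J], when [Q] is the derivative of [J]: the formula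
   gives the same value for the covariant derivative as for the plain one. *)
Definition torsion v w : 'rV[R]_m :=
  w *m Q (v *m J) - v *m Q (w *m J) + v *m Q w *m J - w *m Q v *m J.

Hypothesis Gsym : G^T = G.
Hypothesis Gpos : forall v, v != 0 -> 0 < inner G v v.
Hypothesis JJ : J *m J = - 1%:M.
Hypothesis Jskew : forall v w, inner G (v *m J) w = - inner G v (w *m J).
Hypothesis Qskew : forall x v w, inner G (v *m Q x) w = - inner G v (w *m Q x).
Hypothesis QJ : forall x, Q x *m J = - (J *m Q x).
Hypothesis kerJ : forall u, u *m D = 0 -> u *m J *m D = 0.
Hypothesis kerQ : forall u, u *m D = 0 -> Q u = 0.
Hypothesis rkD : (\rank D + 2 = m)%N.
Hypothesis torsionD : forall v w, torsion v w *m D = 0.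

Let vQJ x v : v *m Q x *m J = - (v *m J *m Q x).
Proof. by rewrite -mulmxA QJ mulmxN mulmxA. Qed.

Let vJJ v : v *m J *m J = - v.
Proof. by rewrite -mulmxA JJ mulmxN mulmx1. Qed.

Lemma inner_Q_diag x v : inner G (v *m Q x) v = 0.
Proof. by have := Qskew x v v; rewrite [in RHS]innerC //; lra. Qed.

(** Moving [J] and then [Q x] across the form, with one anticommutation between, returns the same
    number with the opposite sign. *)
Lemma inner_Q_J x v : inner G (v *m Q x) (v *m J) = 0.
Proof.
have := Qskew x v (v *m J).
rewrite -[v *m J *m Q x]opprK -vQJ innerNr opprK.
by have := Jskew v (v *m Q x); rewrite innerC //; lra.
Qed.

Lemma torsion_vertical v u : u *m D = 0 -> torsion v u = 0.
Proof.
move=> uD; have [->|u0] := eqVneq u 0.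
  by rewrite /torsion !mul0mx kerQ ?mul0mx // mulmx0 mul0mx !subr0 addr0.
have uJD := kerJ uD.
have E : torsion v u = u *m Q (v *m J) - u *m Q v *m J.
  by rewrite /torsion (kerQ uD) (kerQ uJD) !mulmx0 mul0mx subr0 addr0.
(* The vectors [u] and [u *m J] form an orthogonal basis of the kernel plane. *)
apply: (@plane_orthogonal_eq0 _ _ G _ D _ u (u *m J)) => //.
- apply: contra_neq u0 => uJ.
  by apply: oppr_inj; rewrite oppr0 -vJJ uJ mul0mx.
- by have := Jskew u u; rewrite [LHS]innerC //; lra.
- by rewrite E innerDl innerNl inner_Q_diag Jskew inner_Q_J; lra.
- rewrite E innerDl innerNl inner_Q_J Jskew vJJ innerNr inner_Q_diag; lra.
Qed.

Lemma torsion_eq0 v w : torsion v w = 0.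
Proof.
(* The torsion is itself vertical, so it may be paired with itself. *)
suff ortho u : u *m D = 0 -> inner G (torsion v w) u = 0.
  by apply: (inner_eq0 Gpos); apply: ortho; exact: torsionD.
move=> uD.
have Qu x : u *m Q (x *m J) = u *m Q x *m J.
  have := torsion_vertical x uD.
  rewrite /torsion (kerQ uD) (kerQ (kerJ uD)) !mulmx0 mul0mx subr0 addr0.
  by move=> /eqP; rewrite subr_eq0 => /eqP.
(* With [QJG] and [QG] all four terms of the torsion take the form [inner G (u *m Q x *m J) y] up to
   sign, and they cancel in pairs. *)
have QJG x y : inner G (y *m Q x *m J) u = - inner G (u *m Q x *m J) y.
  rewrite Jskew Qskew opprK innerC // -[_ *m J *m Q x]opprK -vQJ innerNl //.
have QG x y : inner G (y *m Q (x *m J)) u = - inner G (u *m Q x *m J) y.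
  by rewrite Qskew Qu innerC.
by rewrite /torsion !(innerDl, innerNl) !QG !QJG; lra.
Qed.

End Torsion.

(** * Symmetry of second derivatives *)

Section Calculus.
Variables (R : realType) (V : normedModType R).
Implicit Types (x v w : V).

Lemma differentiable_expand (f : V -> R) x (e : R) : 0 < e ->
  differentiable f x ->
  \forall y \near x, `|f y - f x - 'd f x (y - x)| <= e * `|y - x|.
Proof.
move=> e0 /diff_locally /eqaddoP /(_ _ e0) H.
apply/nbhs0P; apply: filterS H => k /=.
by rewrite [x + k]addrC addrK !fctE /= opprD addrA.
Qed.

Lemma is_derive_line (f : V -> R) v y (t : R) :
  differentiable f (t *: v + y) ->
  is_derive t 1 (fun s : R => f (s *: v + y)) ('D_v f (t *: v + y)).
Proof.
move=> df.
have lin : is_diff t (fun s : R => s *: v + y) ( *:%R^~ v : R -> V).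
  have := is_diffD (is_diff_scalel t v) (is_diff_cst y t).
  by rewrite addr0.
have dl : differentiable (fun s : R => s *: v + y) t by [].
have df1 : differentiable (f \o (fun s : R => s *: v + y)) t.
  exact: differentiable_comp.
apply: DeriveDef; first exact: diff_derivable.
rewrite deriveE // diff_comp //= diff_val scale1r deriveE //.
Qed.

(* The second difference of [f] over the parallelogram spanned by [h v] and
   [h w]: the mean value theorem in the direction [v], followed by the
   differentiability of ['D_v f], computes it up to [o(h ^ 2)]. *)
Lemma second_difference (f : V -> R) x v w (e : R) : 0 < e ->
  (\forall y \near x, differentiable f y) ->
  differentiable ('D_v f) x ->
  \forall h \near 0^'+,
    `|f (h *: v + (h *: w + x)) - f (h *: v + x) - (f (h *: w + x) - f x)
      - h ^+ 2 * 'D_w ('D_v f) x| <= e * h ^+ 2.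
Proof.
move=> e0 df dg.
(* The two expansions below are taken at distances at most [h * |v|] and [h * (|v| + |w|)] from [x],
   so their errors add up to less than [e / C * (h * C)]; the summand 1 keeps [C] positive. *)
pose C := `|v| + `|v| + `|w| + 1.
have C0 : 0 < C by rewrite /C; have := normr_ge0 v; have := normr_ge0 w; lra.
have : \forall y \near x, differentiable f y /\
    `|'D_v f y - 'D_v f x - 'd ('D_v f) x (y - x)| <= e / C * `|y - x|.
  by near=> y; split; near: y => //; apply: differentiable_expand => //;
    rewrite divr_gt0.
move=> /nbhs_ballP[d /= d0 Hd].
near=> h.
have h0 : 0 < h by near: h; exact: nbhs_right_gt.
have hd : h * C < d.
  by rewrite -ltr_pdivlMr //; near: h; apply: nbhs_right_lt; rewrite divr_gt0.
have P y : `|y - x| <= h * (`|v| + `|w|) -> differentiable f y /\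
    `|'D_v f y - 'D_v f x - 'd ('D_v f) x (y - x)| <= e / C * `|y - x|.
  move=> yx; apply: Hd; rewrite -ball_normE /= distrC.
  by apply: le_lt_trans yx (le_lt_trans _ hd); rewrite ler_pM2l // /C;
    have := normr_ge0 v; lra.
have N1 t : 0 <= t -> t <= h -> `|t *: v + x - x| <= t * `|v|.
  by move=> t0 th; rewrite addrK normrZ ger0_norm.
have N2 t : 0 <= t -> t <= h ->
    `|t *: v + (h *: w + x) - x| <= t * `|v| + h * `|w|.
  move=> t0 th; rewrite addrA addrK (le_trans (ler_normD _ _)) //.
  by rewrite !normrZ !ger0_norm // ltW.
have nv := normr_ge0 v; have nw := normr_ge0 w.
have P1 t : 0 <= t -> t <= h -> differentiable f (t *: v + x).
  by move=> t0 th; apply: (P _ _).1; apply: le_trans (N1 _ t0 th) _; nra.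
have P2 t : 0 <= t -> t <= h -> differentiable f (t *: v + (h *: w + x)).
  by move=> t0 th; apply: (P _ _).1; apply: le_trans (N2 _ t0 th) _; nra.
(* The second difference is [F h - F 0]. *)
pose F t := f (t *: v + (h *: w + x)) - f (t *: v + x).
pose F' t := 'D_v f (t *: v + (h *: w + x)) - 'D_v f (t *: v + x).
have FF' t : 0 <= t -> t <= h -> is_derive t 1 F (F' t).
  by move=> t0 th; apply: is_deriveB; apply: is_derive_line; [exact: P2|exact: P1].
have [|||c] := @MVT R F F' 0 h.
- by [].
- by move=> t; rewrite in_itv /= => /andP[t0 th]; apply: FF'; exact: ltW.
- apply: derivable_within_continuous => t; rewrite in_itv /= => /andP[t0 th].
  by have /@ex_derive := FF' t t0 th.
rewrite in_itv /= => /andP[c0 ch]; rewrite /F !scale0r !add0r subr0 => FE.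
rewrite [X in `|X - _|](_ : _ = F' c * h); last by rewrite -FE; ring.
have c0' := ltW c0; have ch' := ltW ch.
have b1 := N1 c c0' ch'; have b2 := N2 c c0' ch'.
have cv : c * `|v| <= h * `|v| by rewrite ler_wpM2r.
have hw : 0 <= h * `|w| by rewrite mulr_ge0 // ltW.
have [|_ A1] := P (c *: v + x); first by apply: le_trans b1 _; lra.
have [|_ A2] := P (c *: v + (h *: w + x)); first by apply: le_trans b2 _; lra.
have eC : 0 < e / C by rewrite divr_gt0.
have eCC : e / C * C = e by rewrite divfK // gt_eqF.
have {}A1 := le_trans A1 (ler_wpM2l (ltW eC) b1).
have {}A2 := le_trans A2 (ler_wpM2l (ltW eC) b2).
(* The two points differ by [h *: w], so the linear parts do not depend on the unknown [c]. *)
have LE : 'd ('D_v f) x (c *: v + (h *: w + x) - x) -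
    'd ('D_v f) x (c *: v + x - x) = h * 'D_w ('D_v f) x.
  by rewrite deriveE // -linearB -linearZ /=; congr ('d _ _ _);
    rewrite [_ + (_ + x)]addrA !addrK addrAC subrr add0r.
have : `|F' c - h * 'D_w ('D_v f) x| <= e * h.
  rewrite -LE /F'.
  move: A1 A2; move: (e / C) eC eCC => q q0 qC.
  rewrite -{1}qC /C !ler_norml => /andP[lo1 up1] /andP[lo2 up2].
  have qv : q * (c * `|v|) <= q * (h * `|v|) by rewrite ler_wpM2l // ltW.
  have qh : 0 < q * h by exact: mulr_gt0.
  by apply/andP; clear -lo1 up1 lo2 up2 qv qh; split; lra.
move=> bound.
rewrite (_ : F' c * h - _ = (F' c - h * 'D_w ('D_v f) x) * h); last by ring.
by rewrite normrM (gtr0_norm h0) expr2 mulrA ler_pM2r.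
Unshelve. all: by end_near. Qed.

(** The second difference is symmetric in [v] and [w], so for small [h] it lies within
    [e / 2 * h ^+ 2] of [h ^+ 2] times either mixed derivative; dividing by [h ^+ 2] leaves a gap of
    at most [e]. *)
Lemma derive_comm (f : V -> R) x v w :
  (\forall y \near x, differentiable f y) ->
  differentiable ('D_v f) x -> differentiable ('D_w f) x ->
  'D_v ('D_w f) x = 'D_w ('D_v f) x.
Proof.
move=> df dv dw; apply/eqP; rewrite -subr_eq0 -normr_le0.
apply/ler_addgt0Pl => e e0; rewrite addr0.
have e2 : 0 < e / 2 by rewrite divr_gt0.
have [h [[/= h0 A] B]] := filter_ex (filterI (filterI (@nbhs_right_gt R 0)
  (second_difference w e2 df dv)) (second_difference v e2 df dw)).
move: B; rewrite [h *: w + (h *: v + x)]addrCA.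
move: ('D_v ('D_w f) x) ('D_w ('D_v f) x) A => L L'.
move: (f _) (f _) (f _) (f _) => s r q p A B.
have hh : 0 < h ^+ 2 by exact: exprn_gt0.
rewrite -(ler_pM2l hh) -{1}(gtr0_norm hh) -normrM mulrBr.
have -> : h ^+ 2 * L - h ^+ 2 * L' =
    (p - q - (r - s) - h ^+ 2 * L') - (p - r - (q - s) - h ^+ 2 * L) by ring.
apply: le_trans (le_trans (ler_normB _ _) (lerD A B)) _.
by rewrite -mulrDl -splitr mulrC.
Qed.

End Calculus.

(** * Derivatives of matrix-valued functions and of jacobians *)

Section MatrixCalculus.
Variables (R : realType).

Lemma addmxE p q (A B : 'M[R]_(p, q)) i j : (A + B) i j = A i j + B i j.
Proof. by rewrite mxE. Qed.

Lemma oppmxE p q (A : 'M[R]_(p, q)) i j : (- A) i j = - A i j.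
Proof. by rewrite mxE. Qed.

Lemma eq_mulmx_rV p q (A B : 'M[R]_(p, q)) :
  (forall v : 'rV_p, v *m A = v *m B) -> A = B.
Proof. by move=> AB; apply/row_matrixP => i; rewrite !rowE. Qed.

Lemma eq_mulmx_rVcV p q (A B : 'M[R]_(p, q)) :
  (forall (v : 'rV_p) (w : 'rV_q),
    (v *m A *m w^T) 0 0 = (v *m B *m w^T) 0 0) -> A = B.
Proof.
move=> AB; apply: eq_mulmx_rV => v; apply/rowP => j.
by have := AB v (delta_mx 0 j); rewrite trmx_delta -!colE ![col _ _ _ _]mxE.
Qed.

Section Derive.
Variable V : normedModType R.
Implicit Types (x v : V).

Lemma near_eq_differentiable (W : normedModType R) (f g : V -> W) x :
  (\forall y \near x, f y = g y) -> differentiable f x -> differentiable g x.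
Proof.
move=> fg /diff_locallyP[dfc /eqaddoP dfE].
have gE : g \o shift x = cst (g x) + 'd f x +o_ (nbhs (0 : V)) id.
  apply/eqaddoP => e e0; have := dfE e e0.
  apply: filterS2 (iffLR (nbhs0P _ _) fg) => h /= fgh.
  by rewrite !fctE /= [h + x]addrC fgh (nbhs_singleton fg).
by apply/diff_locallyP; rewrite (diff_unique dfc gE).
Qed.

Lemma is_derive_mxP p q (A : V -> 'M[R]_(p, q)) x v (dA : 'M[R]_(p, q)) :
  is_derive x v A dA <-> forall i j, is_derive x v (fun y => A y i j) (dA i j).
Proof.
split=> [[Ad <-] i j|H].
  by apply: DeriveDef; [exact: (derivable_mxP _ _ _).1|rewrite derive_mx // mxE].
have Ad : derivable A x v by apply/derivable_mxP => i j; have [] := H i j.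
apply: DeriveDef => //; rewrite derive_mx //; apply/matrixP => i j.
by rewrite mxE; have [] := H i j.
Qed.

Lemma is_derive_mulmx p q r (A : V -> 'M[R]_(p, q)) (B : V -> 'M[R]_(q, r))
    x v dA dB :
  is_derive x v A dA -> is_derive x v B dB ->
  is_derive x v (fun y => A y *m B y) (dA *m B x + A x *m dB).
Proof.
move=> /is_derive_mxP hA /is_derive_mxP hB; apply/is_derive_mxP => i j.
rewrite (_ : (fun y => _) = \sum_k (fun y => A y i k * B y k j)); last first.
  by apply/funext => y; rewrite mxE fct_sumE.
rewrite [X in is_derive _ _ _ X](_ : _ =
    \sum_k (A x i k *: dB k j + B x k j *: dA i k)); last first.
  rewrite !mxE -big_split; apply: eq_bigr => k _.
  by rewrite /= addrC; congr (_ + _); exact: mulrC.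
by apply: is_derive_sum => k; exact: is_deriveM.
Qed.

Lemma is_derive_trmx p q (A : V -> 'M[R]_(p, q)) x v dA :
  is_derive x v A dA -> is_derive x v (fun y => (A y)^T) dA^T.
Proof.
move=> /is_derive_mxP hA; apply/is_derive_mxP => i j.
rewrite mxE (_ : (fun y => _) = (fun y => A y j i)) //.
by apply/funext => y; rewrite mxE.
Qed.

Lemma derive_entry p q (A : V -> 'M[R]_(p, q)) x v i j : derivable A x v ->
  'D_v A x i j = 'D_v (fun y => A y i j) x.
Proof. by move=> dA; rewrite derive_mx // mxE. Qed.

Lemma differentiable_entry p q (A : V -> 'M[R]_(p, q)) x i j :
  differentiable A x -> differentiable (fun y => A y i j) x.
Proof.
move=> dA.
exact: (@differentiable_comp _ _ _ _ A (fun M : 'M[R]_(p, q) => M i j) x dA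
  (differentiable_coord _ _ _)).
Qed.

Lemma derive_comm_mx p q (f : V -> 'M[R]_(p, q)) x v w :
  (\forall y \near x, differentiable f y) ->
  differentiable ('D_v f) x -> differentiable ('D_w f) x ->
  'D_v ('D_w f) x = 'D_w ('D_v f) x.
Proof.
move=> df dv dw; apply/matrixP => i j.
have near_entry u : \forall y \near x,
    'D_u f y i j = 'D_u (fun y => f y i j) y.
  by apply: filterS df => y dfy; rewrite derive_entry //; exact: diff_derivable.
have diff_near u : differentiable ('D_u f) x ->
    differentiable ('D_u (fun y => f y i j)) x.
  by move=> /(differentiable_entry i j) /(near_eq_differentiable (near_entry u)).
have entry2 u u' : differentiable ('D_u f) x ->
    'D_u' ('D_u f) x i j = 'D_u' ('D_u (fun y => f y i j)) x.
  move=> du; have du' : derivable ('D_u f) x u' by exact: diff_derivable.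
  by rewrite (derive_entry i j du') (near_eq_derive u' (near_entry u)).
apply: etrans (entry2 w v dw) (etrans _ (esym (entry2 v w dv))).
apply: (derive_comm _ (diff_near v dv) (diff_near w dw)).
by apply: filterS df => y; exact: differentiable_entry.
Qed.

End Derive.

Section RowVectors.
Variables m k : nat.
Implicit Types (x v w : 'rV[R]_m).

Lemma derive_sum_delta (W : normedModType R) (f : 'rV[R]_m -> W) x v :
  differentiable f x -> 'D_v f x = \sum_i v 0 i *: 'D_(delta_mx 0 i) f x.
Proof.
move=> df; rewrite deriveE // {1}[v]row_sum_delta linear_sum.
by apply: eq_bigr => i _; rewrite linearZ /= deriveE.
Qed.

Lemma derive_comp_jacobian (W : normedModType R) (f : 'rV[R]_m -> 'rV[R]_k)
    (K : 'rV[R]_k -> W) x v :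
  differentiable f x -> differentiable K (f x) ->
  is_derive x v (K \o f) ('D_(v *m jacobian f x) K (f x)).
Proof.
move=> df dK; have dc : differentiable (K \o f) x by exact: differentiable_comp.
apply: DeriveDef; first exact: diff_derivable.
by rewrite deriveE // diff_comp //= -deriveEjacobian // !deriveE.
Qed.

Lemma derivable_jacobian (f : 'rV[R]_m -> 'rV[R]_k) x v :
  (\forall y \near x, differentiable f y) ->
  (forall u, differentiable ('D_u f) x) -> derivable (jacobian f) x v.
Proof.
move=> df d2f; apply/derivable_mxP => i j; apply: diff_derivable.
apply: near_eq_differentiable (differentiable_entry 0 j (d2f (delta_mx 0 i))).
by apply: filterS df => y dfy; rewrite deriveEjacobian // -rowE mxE.
Qed.

(** The row [u *m jacobian f] is ['D_u f] near [x], so both sides are mixed second derivatives of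
    [f]. *)
Lemma derive_jacobian_sym (f : 'rV[R]_m -> 'rV[R]_k) x v w :
  (\forall y \near x, differentiable f y) ->
  (forall u, differentiable ('D_u f) x) ->
  v *m 'D_w (jacobian f) x = w *m 'D_v (jacobian f) x.
Proof.
move=> df d2f; have E u u' : u *m 'D_u' (jacobian f) x = 'D_u' ('D_u f) x.
  have /derivableP dJ : derivable (jacobian f) x u'.
    exact: derivable_jacobian.
  have := is_derive_mulmx (is_derive_cst u x u') dJ.
  rewrite mul0mx add0r => dE.
  have JE : \forall y \near x, cst u y *m jacobian f y = 'D_u f y.
    by apply: filterS df => y dfy; rewrite deriveEjacobian.
  by have [_ ->] := near_eq_is_derive JE dE.
apply: etrans (E v w) (etrans _ (esym (E w v))).
exact: (derive_comm_mx df (d2f w) (d2f v)).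
Qed.

End RowVectors.
End MatrixCalculus.

(* [ring] and [lra] compare atoms up to conversion, which can unfold distinct
   matrix products or derivatives without end; hence the generalization. *)
Ltac generalize_entries :=
  rewrite ?(addmxE, oppmxE);
  repeat match goal with
  | |- context [fun_of_matrix ?A ?i ?j] => move: (A i j) => ?
  end.

Ltac additive := apply/matrixP => ? ?; generalize_entries; ring.

Lemma smooth_on_cst (R : realType) (V W : normedModType R) (U : set V) (c : W) :
  smooth_on U (cst c).
Proof.
move=> vs x _.
suff [c' ->] : exists c', foldr (fun v h => 'D_v h) (cst c) vs = cst c' by [].
elim: vs => [|v vs [c' /= ->]]; first by exists c.
by exists 0; apply/funext => y; rewrite derive_cst.
Qed.

(** * The Levi-Civita connection and the covariant derivative of an endomorphism field *)

Section Connection.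
Variables (R : realType) (m : nat) (M : manifold R m).
Implicit Types (a : atlas_index M) (x v w : 'rV[R]_m).

Lemma nbhs_cimg a x : cimg (atlas a) x -> nbhs x (cimg (atlas a)).
Proof.
by move=> ax; apply: open_nbhs_nbhs; split => //; exact: cimg_open.
Qed.

Section Metric.
Variables (g : riemannian_metric M) (a : atlas_index M) (x : 'rV[R]_m).
Hypothesis ax : cimg (atlas a) x.

Lemma metric_inner_pos v : v != 0 -> 0 < inner (g a x) v v.
Proof. exact: gmat_pos. Qed.

(* [w *m connection v] is the Christoffel term of [nabla g a x v] on a field
   with value [w] at [x]. *)
Definition connection v : 'M[R]_m :=
  \matrix_(j, l) \sum_i v 0 i * christoffel g a x l i j.

Lemma nablaE v (Y : 'rV[R]_m -> 'rV[R]_m) :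
  nabla g a x v Y = 'D_v Y x + Y x *m connection v.
Proof.
congr (_ + _); apply/rowP => l; rewrite !mxE exchange_big /=.
apply: eq_bigr => j _; rewrite mxE mulr_sumr; apply: eq_bigr => i _.
by rewrite mulrA [_ * v 0 i]mulrC.
Qed.

Lemma dgmatC i j l : dgmat g a x i j l = dgmat g a x i l j.
Proof.
have dG : derivable (g a) x (delta_mx 0 i).
  by apply: diff_derivable; exact: (gmat_smooth g [::]).
rewrite /dgmat !derive_entry //; apply: near_eq_derive.
apply: filterS (nbhs_cimg ax) => y ay.
by rewrite -{1}(gmat_sym g ay) mxE.
Qed.

Lemma christoffelC l i j : christoffel g a x l i j = christoffel g a x l j i.
Proof.
congr (_ * _); apply: eq_bigr => k _; rewrite (dgmatC k i j).
by congr (_ * _); ring.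
Qed.

(** The connection is torsion-free. *)
Lemma connectionC v w : w *m connection v = v *m connection w.
Proof.
apply/rowP => l; rewrite !mxE.
under eq_bigr do rewrite mxE mulr_sumr.
rewrite exchange_big; apply: eq_bigr => i _; rewrite mxE mulr_sumr.
by apply: eq_bigr => j _; rewrite christoffelC; ring.
Qed.

Lemma christoffel_lower i j l : \sum_k christoffel g a x k i j * g a x k l =
  2^-1 * (dgmat g a x i j l + dgmat g a x j i l - dgmat g a x l i j).
Proof.
rewrite /christoffel; under eq_bigr do rewrite -mulrA mulr_suml.
rewrite -mulr_sumr exchange_big /=; congr (_ * _).
have gK : g a x *m invmx (g a x) = 1%:M.
  by apply: mulmxV; apply: inner_unitmx; exact: metric_inner_pos.
transitivity (\sum_p (g a x *m invmx (g a x)) l p *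
    (dgmat g a x i j p + dgmat g a x j i p - dgmat g a x p i j)).
  apply: eq_bigr => p _; rewrite mxE mulr_suml; apply: eq_bigr => k _.
  have -> : g a x k l = g a x l k by rewrite -[in LHS](gmat_sym g ax) mxE.
  by ring.
rewrite gK (bigD1 l) //= mxE eqxx mul1r big1 ?addr0 // => p /negPf pl.
by rewrite mxE eq_sym pl mul0r.
Qed.

(** The metric is parallel: of the six derivatives in the two lowered Christoffel symbols, four
    cancel and two agree. *)
Lemma connection_metric v :
  connection v *m g a x + g a x *m (connection v)^T = 'D_v (g a) x.
Proof.
have lower j l : (connection v *m g a x) j l = \sum_i v 0 i *
    (2^-1 * (dgmat g a x i j l + dgmat g a x j i l - dgmat g a x l i j)).
  rewrite mxE; under eq_bigr do rewrite mxE mulr_suml.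
  rewrite exchange_big; apply: eq_bigr => i _; rewrite -christoffel_lower.
  by rewrite mulr_sumr; apply: eq_bigr => k _; rewrite mulrA.
have <- : (connection v *m g a x)^T = g a x *m (connection v)^T.
  by rewrite trmx_mul (gmat_sym g ax).
rewrite derive_sum_delta; last exact: (gmat_smooth g [::]).
apply/matrixP => j l; rewrite summxE mxE lower mxE lower -big_split.
apply: eq_bigr => i _; rewrite [RHS]mxE -/(dgmat g a x i j l) (dgmatC i l j).
by rewrite /=; lra.
Qed.

End Metric.

Section Torsion.
Variables (J : endo M) (a : atlas_index M) (x : 'rV[R]_m).
Hypothesis ax : cimg (atlas a) x.

Lemma is_derive_endo v : is_derive x v (J a) ('D_v (J a) x).
Proof. by apply/derivableP/diff_derivable; exact: (emat_smooth J [::]). Qed.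

(** By the product rule, the derivatives of [X] and [Y] cancel thanks to [J ^ 2 = -1], leaving only
    those of [J]. *)
Lemma nijenhuisE (X Y : 'rV[R]_m -> 'rV[R]_m) :
  J a x *m J a x = - 1%:M ->
  smooth_on (cimg (atlas a)) X -> smooth_on (cimg (atlas a)) Y ->
  nijenhuis J a X Y x = torsion (J a x) (fun v => 'D_v (J a) x) (X x) (Y x).
Proof.
move=> JJ sX sY.
(* [D] and [P] hide the derivatives, on which conversion diverges. *)
have [D DE] : exists D : 'rV[R]_m -> ('rV[R]_m -> 'rV[R]_m) -> 'rV[R]_m,
  forall v Z, 'D_v Z x = D v Z by exists (fun v Z => 'D_v Z x).
have [P PE] : exists P : 'rV[R]_m -> 'M[R]_m, forall v, 'D_v (J a) x = P v.
  by exists (fun v => 'D_v (J a) x).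
have dJ (Z : 'rV[R]_m -> 'rV[R]_m) v : smooth_on (cimg (atlas a)) Z ->
    D v (endo_act J a Z) = D v Z *m J a x + Z x *m P v.
  move=> sZ; have /derivableP dZ : derivable Z x v.
    by apply: diff_derivable; exact: (sZ [::]).
  by rewrite -DE -DE -PE; have [] := is_derive_mulmx dZ (is_derive_endo v).
rewrite /nijenhuis /lie /torsion !DE !PE !dJ // /endo_act.
have vJJ v : v *m J a x *m J a x = - v by rewrite -mulmxA JJ mulmxN mulmx1.
rewrite !(mulmxDl, mulNmx, vJJ).
additive.
Qed.

Variable g : riemannian_metric M.

(** The matrix of the map sending [Y] to [nabla_v (Y J) - (nabla_v Y) J], in which the derivatives
    of [Y] cancel. *)
Definition covariant_derivative v : 'M[R]_m :=
  'D_v (J a) x + J a x *m connection g a x v - connection g a x v *m J a x.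

(** The Christoffel terms cancel because the connection is torsion-free. *)
Lemma torsion_covariant v w :
  torsion (J a x) covariant_derivative v w =
  torsion (J a x) (fun v => 'D_v (J a) x) v w.
Proof.
have [P PE] : exists P : 'rV[R]_m -> 'M[R]_m, forall v, 'D_v (J a) x = P v.
  by exists (fun v => 'D_v (J a) x).
rewrite /torsion /covariant_derivative !PE.
move: (connection g a x) (connectionC g ax) (J a x) => C CC K.
rewrite !(mulmxDr, mulmxDl, mulmxN, mulNmx) !mulmxA.
rewrite (CC w (v *m _)) (CC w v) (CC (w *m _) v) (CC (w *m _) (v *m _)).
additive.
Qed.

Lemma parallel_covariant v :
  parallel_along g J a x v -> covariant_derivative v = 0.
Proof.
move=> par; apply: eq_mulmx_rV => w; rewrite mulmx0.
(* Constant fields reach every value at [x] and have zero derivative. *)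
have sw : smooth_on (cimg (atlas a)) (cst w : 'rV[R]_m -> 'rV[R]_m).
  exact: smooth_on_cst.
have := par _ sw; rewrite !nablaE derive_cst.
have [_] := is_derive_mulmx (is_derive_cst w x v) (is_derive_endo v).
rewrite mul0mx add0r => -> /eqP.
rewrite add0r /endo_act /covariant_derivative !(mulmxDr, mulmxN) !mulmxA.
by rewrite -subr_eq0 => /eqP.
Qed.

(** Differentiating [J ^ 2 = -1] gives this for ['D_v J]; the commutator of [J] with any matrix also
    anticommutes with [J]. *)
Lemma covariant_derivative_anticomm v :
  almost_complex J ->
  covariant_derivative v *m J a x = - (J a x *m covariant_derivative v).
Proof.
move=> JJ; have dJ := is_derive_endo v.
have E : \forall y \near x, cst (- 1%:M) y = J a y *m J a y.
  by apply: filterS (nbhs_cimg ax) => y ay; rewrite JJ.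
have [_ dE0] := near_eq_is_derive E (is_derive_cst _ x v).
have [_ dE1] := is_derive_mulmx dJ dJ.
have /eqP := etrans (esym dE1) dE0.
rewrite addr_eq0 /covariant_derivative.
move: ('D_v (J a) x) (connection g a x v) (J a x) (JJ a x ax) => P C K KK.
move=> /eqP PK.
rewrite !(mulmxDr, mulmxDl, mulmxN, mulNmx) PK !mulmxA KK -[_ *m K *m K]mulmxA.
rewrite KK mulmxN mulmx1 mulNmx mul1mx.
additive.
Qed.

(** The identity [J g = - g J^T] is differentiated, hence assumed near [x], and the derivative of
    [g] is then replaced using that [g] is parallel. *)
Lemma covariant_derivative_skew v :
  (\forall y \near x, forall u w,
    inner (g a y) (u *m J a y) w = - inner (g a y) u (w *m J a y)) ->
  forall u w, inner (g a x) (u *m covariant_derivative v) w =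
            - inner (g a x) u (w *m covariant_derivative v).
Proof.
move=> Jskew u w.
have skewE : \forall y \near x, J a y *m g a y = - (g a y *m (J a y)^T).
  apply: filterS Jskew => y Jy; apply: eq_mulmx_rVcV => p q.
  have := Jy p q; rewrite inner_trmx /inner mulmxN mulNmx oppmxE => <-.
  by rewrite !mulmxA.
have dJ := is_derive_endo v.
have /derivableP dG : derivable (g a) x v.
  by apply: diff_derivable; exact: (gmat_smooth g [::]).
have skewx := nbhs_singleton skewE.
have [_ d1] := near_eq_is_derive skewE (is_derive_mulmx dJ dG).
have [_ d2] := is_deriveN (is_derive_mulmx dG (is_derive_trmx dJ)).
have d12 := etrans (esym d1) d2.
suff QG : covariant_derivative v *m g a x = - (g a x *m (covariant_derivative v)^T).
  by rewrite inner_trmx /inner -[u *m _ *m _]mulmxA QG mulmxN mulNmx oppmxE.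
move: d12; rewrite /covariant_derivative -(connection_metric g ax v).
move: ('D_v (J a) x) (connection g a x v) (J a x) (g a x) skewx => P C K G KG.
rewrite !linearD linearN /= !trmx_mul.
rewrite !(mulmxDr, mulmxDl, mulmxN, mulNmx) !mulmxA.
rewrite -[C *m K *m G]mulmxA KG !(mulmxN, mulNmx) !mulmxA => h.
apply/matrixP => i j; move: (congr1 (fun A : 'M[R]_m => A i j) h).
rewrite /=; generalize_entries; lra.
Qed.

End Torsion.
End Connection.

Lemma inner_diag_skew (R : realType) (m : nat) (G K : 'M[R]_m) :
  G^T = G -> (forall v, inner G (v *m K) v = 0) ->
  forall v w, inner G (v *m K) w = - inner G v (w *m K).
Proof.
move=> Gsym K0 v w; have := K0 (v + w).
rewrite mulmxDl !(innerDl, innerDr) !K0 (innerC v (w *m K) Gsym); lra.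
Qed.

Lemma compatible_skew (R : realType) (m : nat) (G K : 'M[R]_m) :
  K *m K = - 1%:M ->
  (forall v w, inner G (v *m K) (w *m K) = inner G v w) ->
  forall v w, inner G (v *m K) w = - inner G v (w *m K).
Proof.
move=> KK Kiso v w; rewrite -(Kiso (v *m K)) -[v *m K *m K]mulmxA KK.
by rewrite mulmxN mulmx1 innerNl.
Qed.

(** * The map in charts and the induced structure at a point *)

Section LocalMap.
Variables (R : realType) (m k : nat) (M : manifold R m) (N : manifold R k).
Variables (phi : M -> N).
Hypothesis phi_smooth : smooth_map phi.

Lemma locmap_cimg a b x : locdom phi a b x -> cimg (atlas b) (locmap phi a b x).
Proof. by move=> [_ bx]; exists (phi (cinv (atlas a) x)). Qed.

Lemma nbhs_locdom a b x : locdom phi a b x -> nbhs x (locdom phi a b).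
Proof.
move=> [ax bx]; apply: filterI; first exact: nbhs_cimg.
have cx : {for x, continuous (phi \o cinv (atlas a))}.
  apply: continuous_comp; first exact: cinv_continuous.
  exact: phi_smooth.1.
by apply: cx; apply: open_nbhs_nbhs; split => //; exact: cdom_open.
Qed.

End LocalMap.

Section Pointwise.
Variables (R : realType) (n : nat).
Variables (M : manifold R (2 * n + 2)) (N : manifold R (2 * n)).
Variables (g : riemannian_metric M) (h : riemannian_metric N) (J : endo N).
Variables (phi : M -> N) (s : bool) (J' : endo M).
Hypothesis N_hermitian : hermitian_structure h J.
Hypothesis phi_submersion : submersion phi.
Hypothesis phi_phwc : phwc phi g h J.
Hypothesis J'_induced : induced_structure phi g J s J'.
Variables (a : atlas_index M) (b : atlas_index N) (x : 'rV[R]_(2 * n + 2)).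
Hypothesis abx : locdom phi a b x.

Let G := g a x.
Let D := dmap phi a b x.
Let H := h b (locmap phi a b x).
Let K := J b (locmap phi a b x).
Implicit Types (v w : 'rV[R]_(2 * n + 2)).

(* The horizontal space is the image of the adjoint [B]. *)
Lemma horizontal_vertical_decomposition (B : 'M[R]_(2 * n, 2 * n + 2)) v :
  (forall X E, inner G X (E *m B) = inner H (X *m D) E) ->
  exists c w, v = c *m B + w /\ w *m D = 0.
Proof.
move=> BE; have Nbx := locmap_cimg abx; have [ax _] := abx.
(* The squared length of [c *m B] is [inner H (c *m B *m D) c], and [B] is injective since [D] is
   onto. *)
have BDu : B *m D \in unitmx.
  rewrite -row_free_unit; apply: inj_row_free => c cBD.
  have cB : c *m B = 0.
    apply: (inner_eq0 (metric_inner_pos g ax)).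
    by rewrite BE -mulmxA cBD inner0l.
  have [D1 D1E] := row_fullP (phi_submersion abx).
  apply: (inner_eq0 (metric_inner_pos h Nbx)).
  by rewrite -{1}[c]mulmx1 -D1E mulmxA -BE cB inner0r.
exists (v *m D *m invmx (B *m D)), (v - v *m D *m invmx (B *m D) *m B).
split; first by rewrite addrC subrK.
by rewrite mulmxBl -[_ *m B *m D]mulmxA mulmxKV // subrr.
Qed.

(** The sign [(-1) ^+ s] is a nonzero scalar and drops out of both equations, so [J^+] and [J^-] are
    treated together. *)
Lemma induced_vertical w : w *m D = 0 ->
  w *m J' a x *m D = 0 /\ inner G (w *m J' a x) w = 0.
Proof.
move=> wD; have [_ /(_ w wD) [+ + _ _]] := J'_induced abx.
rewrite /vertical /= -scalemxAl innerZl => /eqP + /eqP.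
by rewrite scaler_eq0 mulf_eq0 signr_eq0 => /eqP -> /eqP ->.
Qed.

Lemma induced_pointwise : J' a x *m D = D *m K /\
  (forall v w, inner G (v *m J' a x) w = - inner G v (w *m J' a x)).
Proof.
have [B BE BK] := phi_phwc abx; have [ax _] := abx.
have Gsym := gmat_sym g ax; have Nbx := locmap_cimg abx.
have hor c : horizontal phi g a b x (c *m B).
  by move=> w wD; rewrite innerC // BE wD inner0l.
have J'hor c : horizontal phi g a b x (c *m B *m J' a x) /\
    c *m B *m J' a x *m D = c *m B *m D *m K.
  by have [+ _] := J'_induced abx; apply.
split.
  apply: eq_mulmx_rV => v; rewrite !mulmxA.
  have [c [w [-> wD]]] := horizontal_vertical_decomposition v BE.
  by rewrite !mulmxDl (J'hor c).2 (induced_vertical wD).1 wD mul0mx.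
apply: inner_diag_skew => // v.
have [c [w [-> wD]]] := horizontal_vertical_decomposition v BE.
(* The mixed and vertical terms vanish, leaving the horizontal one. *)
have [J'wD J'ww] := induced_vertical wD.
rewrite mulmxDl !(innerDl, innerDr) J'ww ((J'hor c).1 w wD).
rewrite [X in _ + (X + _)]innerC // (hor c _ J'wD) !addr0 BE (J'hor c).2.
have Kskew := compatible_skew (N_hermitian.1.1 _ _ Nbx)
  (fun e e' => N_hermitian.2 _ _ e e' Nbx).
have := Kskew (c *m B *m D) c; rewrite -BE.
(* By PHWC the remaining term is [inner G (c *m K *m B) (c *m B)]; skewness of [K] equates it with
   minus the same product with its arguments exchanged. *)
have -> : c *m B *m D *m K = c *m K *m B *m D.
  by rewrite -!mulmxA [B *m (_ *m K)]mulmxA BK.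
by rewrite -BE innerC //; lra.
Qed.

End Pointwise.

(** A holomorphic map carries one torsion to the other: the derivative of the holomorphy equation
    expresses ['D_u J] through ['D_u K] and second derivatives of [f], and the latter cancel by
    symmetry. *)
Lemma torsion_mulmx_jacobian (R : realType) (m k : nat)
    (f : 'rV[R]_m -> 'rV[R]_k) (J : 'rV[R]_m -> 'M[R]_m)
    (K : 'rV[R]_k -> 'M[R]_k) (x : 'rV[R]_m) :
  (\forall y \near x, differentiable f y) ->
  (forall u, differentiable ('D_u f) x) ->
  differentiable J x -> differentiable K (f x) ->
  (\forall y \near x, J y *m jacobian f y = jacobian f y *m K (f y)) ->
  forall v w,
    torsion (J x) (fun u => 'D_u J x) v w *m jacobian f x =
    torsion (K (f x)) (fun u => 'D_u K (f x))
      (v *m jacobian f x) (w *m jacobian f x).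
Proof.
move=> df d2f dJ dK holo v w.
have dfx := nbhs_singleton df; have JD := nbhs_singleton holo.
have sym : forall u u',
    u *m 'D_u' (jacobian f) x = u' *m 'D_u (jacobian f) x.
  by move=> u u'; exact: derive_jacobian_sym.
have PE : forall u, 'D_u J x *m jacobian f x + J x *m 'D_u (jacobian f) x =
    'D_u (jacobian f) x *m K (f x) +
    jacobian f x *m 'D_(u *m jacobian f x) K (f x).
  move=> u.
  have dJu : is_derive x u J ('D_u J x) by apply/derivableP/diff_derivable.
  have dDu : is_derive x u (jacobian f) ('D_u (jacobian f) x).
    by apply/derivableP; exact: derivable_jacobian.
  have [_ d1] := near_eq_is_derive holo (is_derive_mulmx dJu dDu).
  have [_ d2] := is_derive_mulmx dDu (derive_comp_jacobian u dfx dK).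
  exact: etrans (esym d1) d2.
have [P PP] : exists P : 'rV[R]_m -> 'M[R]_m, forall u, 'D_u J x = P u.
  by exists (fun u => 'D_u J x).
have [S SS] : exists S : 'rV[R]_m -> 'M[R]_(m, k),
  forall u, 'D_u (jacobian f) x = S u by exists (fun u => 'D_u (jacobian f) x).
have [Q QQ] : exists Q : 'rV[R]_k -> 'M[R]_k, forall u, 'D_u K (f x) = Q u.
  by exists (fun u => 'D_u K (f x)).
have {}sym u u' : u *m S u' = u' *m S u by rewrite -!SS; exact: sym.
have {}PE u : P u *m jacobian f x = S u *m K (f x) +
    jacobian f x *m Q (u *m jacobian f x) - J x *m S u.
  by apply/eqP; rewrite eq_sym subr_eq -PP -SS -QQ; apply/eqP/esym; exact: PE.
rewrite /torsion !PP !QQ.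
move: (jacobian f x) (J x) (K (f x)) JD PE => D Jx Kx JD PE.
rewrite !(mulmxDl, mulNmx).
have PJ (u u' : 'rV[R]_m) : u *m P u' *m Jx *m D = u *m P u' *m D *m Kx.
  by rewrite -mulmxA JD mulmxA.
have PD (u u' : 'rV[R]_m) : u *m P u' *m D = u *m S u' *m Kx +
    u *m D *m Q (u' *m D) - u *m Jx *m S u'.
  by rewrite -mulmxA PE !(mulmxDr, mulmxN) !mulmxA.
have JDu (u : 'rV[R]_m) : u *m Jx *m D = u *m D *m Kx by rewrite -!mulmxA JD.
rewrite !PJ !PD !JDu !(mulmxDl, mulNmx).
rewrite (sym w (v *m Jx)) (sym v (w *m Jx)) (sym w v).
rewrite (sym (w *m Jx) (v *m Jx)).
additive.
Qed.

(** * Assembly in charts around a point and its image *)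

Theorem theorem5p1 (R : realType) (n : nat)
    (M : manifold R (2 * n + 2)) (M_oriented : oriented M) (g : riemannian_metric M)
    (N : manifold R (2 * n)) (h : riemannian_metric N) (J : endo N)
    (N_hermitian : hermitian_structure h J)
    (phi : M -> N) (phi_smooth : smooth_map phi)
    (phi_submersion : submersion phi) (phi_phwc : phwc phi g h J)
    (s : bool) (J' : endo M) (J'_acs : almost_complex J')
    (J'_induced : induced_structure phi g J s J')
    (fibers_superminimal : superminimal_fibers phi g J') :
  integrable_structure J'.
Proof.
split=> // a X Y sX sY x ax.
have JJ := J'_acs _ _ ax.
rewrite nijenhuisE // -(torsion_covariant J' ax g).
have [b bx] := atlas_cover (phi (cinv (atlas a) x)).
have abx : locdom phi a b x by [].
have near_dom := nbhs_locdom phi_smooth abx.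
have smooth_f := phi_smooth.2 a b.
have pw y : locdom phi a b y -> _ :=
  induced_pointwise N_hermitian phi_submersion phi_phwc J'_induced (x := y).
have Nbx := locmap_cimg abx.
apply: (@torsion_eq0 _ _ _ (g a x) _ (dmap phi a b x)) => //.
- exact: gmat_sym.
- exact: metric_inner_pos.
- exact: (pw x abx).2.
- move=> u; apply: covariant_derivative_skew => //.
  by apply: filterS near_dom => y aby; exact: (pw y aby).2.
- by move=> v; exact: covariant_derivative_anticomm.
- by move=> u uD; rewrite -mulmxA (pw x abx).1 mulmxA uD mul0mx.
- move=> u uD; apply: parallel_covariant => //.
  exact: (fibers_superminimal a b x abx).2.
(* The differential has rank [2 * n], so its kernel is a plane. *)
- by have /eqP -> := phi_submersion a b x abx.
(* Verticality of the torsion is proved with plain derivatives, to which the chain rule applies. *)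
move=> v w; rewrite torsion_covariant // /dmap.
have Kx : differentiable (J b) (locmap phi a b x).
  exact: (emat_smooth J [::]).
rewrite (torsion_mulmx_jacobian (K := J b)) //.
(* Integrability of [J] is applied to the constant fields [e] and [e']. *)
- pose e := v *m jacobian (locmap phi a b) x.
  pose e' := w *m jacobian (locmap phi a b) x.
  have sc (c : 'rV[R]_(2 * n)) :
      smooth_on (cimg (atlas b)) (cst c : 'rV[R]_(2 * n) -> 'rV[R]_(2 * n)).
    exact: smooth_on_cst.
  have [acs nij] := N_hermitian.1.
  by rewrite -(nij b _ _ (sc e) (sc e') _ Nbx) nijenhuisE // acs.
- by apply: filterS near_dom => y aby; exact: (smooth_f [::]).
- by move=> u; exact: (smooth_f [:: u]).
- exact: (emat_smooth J' [::]).
- by apply: filterS near_dom => y aby; exact: (pw y aby).1.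
Qed.
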